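(* Let $(H_n)_{n\ge0}$ be the monic Hermite polynomials, let $M\in\mathbb{R}\setminus\{0\}$, and let $$\langle\mathbf{w}_h,p\rangle=\int_0^\infty[p(x)+p(-x)-2p(0)]\frac{e^{-x^2}}{x^2}\,dx+M\,p(0).$$ Assume $\langle\mathbf{w}_h,H_{2n}\rangle\ne0$ for all $n\ge0$ and let $R_n=H_{n+1}+\beta_nH_{n-1}$ ($n\ge1$), where $\beta_n\in\mathbb{R}$ are such that $R_n'(0)=0$ and $\langle\mathbf{w}_h,R_n\rangle=0$ for all $n\ge1$. Then, for $n\ge1$, $R_n$ satisfies $$R_n''(x)-\Big(2x+\frac{4\beta_n x}{\mathcal{B}(x;n)-\beta_n\mathcal{A}(x;n)}\Big)R_n'(x)+\Big(2n+\frac{2\mathcal{B}(x;n)+2\beta_n\mathcal{A}(x;n)}{\mathcal{B}(x;n)-\beta_n\mathcal{A}(x;n)}\Big)R_n(x)=0,$$ where $$\mathcal{A}(x;n)=n+1-2\beta_n,\qquad\mathcal{B}(x;n)=\frac{n(n+1)}2+(2x^2-n)\beta_n.$$ Moreover, in the particular case $M=-2\sqrt\pi$ the equation reduces to $$R_n''(x)-\Big(2x+\frac2x\Big)R_n'(x)+2(n+1)R_n(x)=0.$$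
   Context: The monic Hermite polynomials are orthogonal with respect to $e^{-x^2}dx$ on $\mathbb{R}$ and satisfy $xH_n=H_{n+1}+\frac n2H_{n-1}$, $H_0=1$, $H_1=x$. The coefficients are $\beta_{2n+1}=-\langle\mathbf{w}_h,H_{2n+2}\rangle/\langle\mathbf{w}_h,H_{2n}\rangle$ ($n\ge0$) and $\beta_{2n}=-H_{2n+1}'(0)/H_{2n-1}'(0)=\frac{2n+1}2$ ($n\ge1$). The differential equations are understood as identities of rational functions in $x$. *)

(* Defs.v *)
From HB Require Import structures.
From mathcomp Require Import all_boot all_order all_algebra.
From mathcomp Require Import all_classical all_reals all_analysis.

Set Implicit Arguments.
Unset Strict Implicit.
Unset Printing Implicit Defensive.

Import Order.TTheory GRing.Theory Num.Theory.
Import numFieldNormedType.Exports.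

Local Open Scope classical_set_scope.
Local Open Scope ring_scope.

(* The monic Hermite polynomials (weight exp(- x^2) on the real line), given by
   H_0 = 1, H_1 = X and H_(k+2) = X H_(k+1) - ((k+1)/2) H_k. *)
Fixpoint hermite (R : realType) (n : nat) : {poly R} :=
  match n with
  | 0%N => 1
  | m.+1 =>
      match m with
      | 0%N => 'X
      | k.+1 => 'X * hermite R m - (m%:R / 2) *: hermite R k
      end
  end.

(* The integrand extends continuously to 0, because p.[x] + p.[- x] - 2 p.[0]
   is divisible by x^2; the integral is thus an absolutely convergent one. *)
Definition wh (R : realType) (M : R) (p : {poly R}) : R :=
  \int[lebesgue_measure]_(x in `]0, +oo[)
    ((p.[x] + p.[- x] - 2 * p.[0]) * (expR (- x ^+ 2) / x ^+ 2))
  + M * p.[0].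

(* Only meant for 1 <= n: n.-1 is the truncated predecessor. *)
Definition Rn (R : realType) (beta : nat -> R) (n : nat) : {poly R} :=
  hermite R n.+1 + beta n *: hermite R n.-1.

Definition Acal (R : realType) (beta : nat -> R) (n : nat) : {poly R} :=
  (n.+1%:R - 2 * beta n)%:P.

Definition Bcal (R : realType) (beta : nat -> R) (n : nat) : {poly R} :=
  ((n * n.+1)%:R / 2)%:P + beta n *: (2 *: 'X^2 - n%:R%:P).

Notation "p %:F" := (tofrac p) : ring_scope.

(* Division in {fraction {poly R}} is total with x / 0 = 0. The denominator in
   the differential equation is nonzero for every choice of beta, so that the
   coefficients are genuine quotients. *)
Lemma ode_denominator_neq0 (R : realType) (beta : nat -> R) (n : nat) :
  (1 <= n)%N -> Bcal beta n - beta n *: Acal beta n != 0.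
Proof.
move=> n1; apply/eqP => D0.
have c2 : (Bcal beta n - beta n *: Acal beta n)`_2 = 0 by rewrite D0 coef0.
have c0 : (Bcal beta n - beta n *: Acal beta n)`_0 = 0 by rewrite D0 coef0.
move: c2; rewrite /Bcal /Acal !(coefD, coefN, coefZ, coefC, coefXn) /=.
rewrite mulr1 mulr0 !subr0 add0r => /eqP; rewrite mulf_eq0 pnatr_eq0 orbF.
move=> /eqP b0.
move: c0; rewrite /Bcal /Acal b0 !scale0r addr0 subr0 coefC /= => /eqP.
rewrite mulf_eq0 invr_eq0 !pnatr_eq0 muln_eq0 /= !orbF.
by case: n n1 D0 b0.
Qed.

(* Main.v *)
(* With D = B - beta A, the Hermite relations give R_n = x H_n + (beta - n/2) H_(n-1)
   and R_n' = A H_n + 2 beta x H_(n-1); the determinant of these two expressions is D,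
   and eliminating H_n, H_(n-1) from R_n, R_n', R_n'' gives the differential equation
   for an arbitrary value of beta_n.
   For M = - 2 sqrt pi the functional w_h is the Hadamard finite part of the
   integral of p(x) exp(- x^2) / x^2 over the real line, so it vanishes on the
   numerators x g' - g - 2 x^2 g of the derivatives of g(x) exp(- x^2) / x.
   The choice g = - H_(2m) / 2 gives w_h(H_(2m+2) + (m+1) H_(2m)) = 0, hence
   beta_n = (n+1)/2 for n odd; for n even, R_n'(0) = A H_n(0) gives the same value.
   Then A = 0 and B = (n+1) x^2. *)

Require Import Defs.
From HB Require Import structures.
From mathcomp Require Import all_boot all_order all_algebra.
From mathcomp Require Import all_classical all_reals all_analysis.
From mathcomp Require Import measurable_realfun.
From mathcomp Require Import ring lra.

Set Implicit Arguments.
Unset Strict Implicit.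
Unset Printing Implicit Defensive.

Import Order.TTheory GRing.Theory Num.Theory.
Import numFieldNormedType.Exports.

Local Open Scope ring_scope.

(** * Integrals of polynomials against the Gaussian weight on the half-line *)

Section GaussianIntegrals.
Variable R : realType.
Implicit Types (x : R) (p q k g : {poly R}).
Local Notation mu := (@lebesgue_measure R).

Lemma expR_exprn_le x n : 0 <= x -> x ^+ n <= n`!%:R * expR x.
Proof.
move=> x0; case: n => [|n].
  by rewrite expr0 fact0 mul1r -expR0 ler_expR.
have := expR_ge1Dxn n x0 => H.
rewrite mulrC -ler_pdivrMr ?ltr0n ?fact_gt0//.
by apply: le_trans H; rewrite lerDr.
Qed.

(** Bounding each monomial by a multiple of exp(x) gives |p(x)| <= S exp(x), and (x - 1)^2 >= 0
    gives exp(x - x^2) <= e exp(- x). This one bound yields both the limit at infinity and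
    integrability. *)
Lemma poly_gauss_bound p : exists2 C : R, 0 <= C &
  forall x, 0 <= x -> `|p.[x] * gauss_fun x| <= C * expR (- x).
Proof.
pose S := \sum_(i < size p) `|p`_i| * i`!%:R.
have S0 : 0 <= S by apply: sumr_ge0 => i _; rewrite mulr_ge0.
exists (S * expR 1); first by rewrite mulr_ge0// expR_ge0.
move=> x x0.
have pS : `|p.[x]| <= S * expR x.
  rewrite horner_coef; apply: le_trans (ler_norm_sum _ _ _) _.
  rewrite mulr_suml; apply: ler_sum => i _.
  rewrite normrM normrX (ger0_norm x0) -mulrA ler_wpM2l//.
  exact: expR_exprn_le.
rewrite normrM (ger0_norm (gauss_fun_ge0 _)).
apply: le_trans (ler_wpM2r (gauss_fun_ge0 _) pS) _.
rewrite -!mulrA ler_wpM2l// /gauss_fun -!expRD ler_expR.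
by have := sqr_ge0 (x - 1); nra.
Qed.

Lemma cvg_poly_gauss p : ((p.[x] * gauss_fun x) @[x --> +oo] --> (0 : R))%classic.
Proof.
have [C C0 bC] := poly_gauss_bound p.
have cC : ((C * expR (- x)) @[x --> +oo] --> (0 : R))%classic.
  by rewrite -[X in (_ --> X)%classic](mulr0 C); apply: cvgMr; exact: cvgr_expR.
apply/norm_cvg0P; apply: squeeze_cvgr cC; last exact: cvg_cst.
near=> x; rewrite normr_ge0 /=.
by apply: bC; near: x; apply: nbhs_pinfty_ge; rewrite num_real.
Unshelve. all: by end_near. Qed.

Lemma continuous_poly_gauss p : continuous (fun x => p.[x] * gauss_fun x).
Proof.
move=> x; apply: cvgM; first exact: continuous_horner.
exact: continuous_gauss_fun.
Qed.

Lemma integrable_expRN :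
  mu.-integrable `[0%R, +oo[%classic (EFin \o (fun x => expR (- x))).
Proof.
have : mu.-integrable `[0%R, +oo[%classic (EFin \o exponential_pdf 1).
  apply: (@integrableS _ _ R mu setT) => //.
  exact: integrable_exponential_pdf.
apply: eq_integrable => // x; rewrite inE/= in_itv/= andbT => x0.
by rewrite exponential_pdfE// mul1r mulN1r.
Qed.

Lemma integrable_poly_gauss p :
  mu.-integrable `[0%R, +oo[%classic (EFin \o (fun x => p.[x] * gauss_fun x)).
Proof.
have [C C0 bC] := poly_gauss_bound p.
apply: (@le_integrable _ _ _ mu _ _ _ (fun x => (C%:E * (expR (- x))%:E)%E)) => //.
- apply/measurable_EFinP.
  apply: measurable_funTS; apply: continuous_measurable_fun.
  exact: continuous_poly_gauss.
- move=> x /=; rewrite in_itv/= andbT => x0.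
  rewrite lee_fin [leRHS]ger0_norm ?bC//.
  by rewrite mulr_ge0// expR_ge0.
- apply: integrableZl => //; exact: integrable_expRN.
Qed.

Global Instance is_derive_gauss x :
  is_derive x 1 (@gauss_fun R) (- 2 * x * gauss_fun x).
Proof.
rewrite /gauss_fun; apply: is_derive_eq.
by rewrite !scaler1; ring.
Qed.

Global Instance is_derive_poly_gauss k x :
  is_derive x 1 (fun x => k.[x] * gauss_fun x)
    ((k^`() - 2 *: ('X * k)).[x] * gauss_fun x).
Proof.
have := is_deriveM (is_derive_poly k x) (is_derive_gauss x).
move=> H; apply: (is_derive_eq H).
rewrite !hornerE /GRing.scale /=; ring.
Qed.

Lemma gauss_fun0 : gauss_fun 0 = 1 :> R.
Proof. by rewrite /gauss_fun expr0n oppr0 expR0. Qed.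

Lemma Rintegral_expRN : \int[mu]_(x in `[0, +oo[) expR (- x) = 1.
Proof.
rewrite (@Rintegral_ge0_continuous_FTC2y R _ (fun x => - expR (- x)) 0 0).
- by rewrite oppr0 expR0 opprK add0r.
- by move=> x _; exact: expR_ge0.
- apply: continuous_subspaceT => x; apply: continuous_comp.
    exact: opp_continuous.
  exact: continuous_expR.
- rewrite -[X in (_ --> X)%classic]oppr0; apply: cvgN; exact: cvgr_expR.
- by move=> x _; exact: ex_derive.
- apply/cvg_at_right_filter; apply: cvgN; apply: continuous_comp.
    exact: opp_continuous.
  exact: continuous_expR.
- move=> x _; rewrite derive1E derive_val; ring.
Qed.

Lemma Rintegral_derive_poly_gauss k :
  \int[mu]_(x in `[0, +oo[) ((k^`() - 2 *: ('X * k)).[x] * gauss_fun x) = - k.[0].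
Proof.
set q := k^`() - _.
(* Adding C exp(- x) makes the integrand nonnegative, as the library's fundamental
   theorem on [0, +oo[ requires. *)
have [C C0 bC] := poly_gauss_bound q.
have cexp x : {for x, continuous (fun x : R => expR (- x))}.
  by apply: continuous_comp; [exact: opp_continuous|exact: continuous_expR].
have iC : mu.-integrable `[0%R, +oo[%classic (EFin \o (fun x => C * expR (- x))).
  exact: integrableZl integrable_expRN.
have : \int[mu]_(x in `[0, +oo[) (q.[x] * gauss_fun x + C * expR (- x))
    = 0 - (k.[0] * gauss_fun 0 - C * expR (- 0)).
  apply: (@Rintegral_ge0_continuous_FTC2y R _
    (fun x => k.[x] * gauss_fun x - C * expR (- x)) 0 0).
  - by move=> x /bC; rewrite ler_norml => /andP[+ _]; rewrite -subr_ge0 opprK addrC.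
  - apply: continuous_subspaceT => x; apply: cvgD.
      exact: continuous_poly_gauss.
    by apply: cvgMr; exact: cexp.
  - rewrite -[X in (_ --> X)%classic]subr0; apply: cvgB; first exact: cvg_poly_gauss.
    rewrite -[X in (_ --> X)%classic](mulr0 C); apply: cvgMr; exact: cvgr_expR.
  - by move=> x _; exact: ex_derive.
  - apply/cvg_at_right_filter; apply: cvgB; first exact: continuous_poly_gauss.
    by apply: cvgMr; exact: cexp.
  - move=> x _; rewrite derive1E derive_val /q /GRing.scale /=; ring.
rewrite RintegralD//; last exact: integrable_poly_gauss.
rewrite RintegralZl//; last exact: integrable_expRN.
rewrite Rintegral_expRN gauss_fun0 oppr0 expR0; lra.
Qed.

Lemma Rintegral_gauss0y : \int[mu]_(x in `[0, +oo[) gauss_fun x = Num.sqrt pi / 2.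
Proof. by rewrite /Rintegral integral0y_gauss. Qed.

End GaussianIntegrals.

(** * The functional w_h: convergence, linearity and vanishing on derivatives *)

Section LinearFunctional.
Variable R : realType.
Implicit Types (x M : R) (p q k g : {poly R}).
Local Notation mu := (@lebesgue_measure R).

Local Notation integrand p := (fun x =>
  (p.[x] + p.[- x] - 2 * p.[0]) * (expR (- x ^+ 2) / x ^+ 2)).

(** The left side is even in x and vanishes at 0, so its derivative vanishes there too and 0 is a
    double root. The singularity 1 / x^2 in [wh] is therefore removable. *)
Lemma symmetrized_divX2 p :
  exists q, forall x, p.[x] + p.[- x] - 2 * p.[0] = x ^+ 2 * q.[x].
Proof.
pose r := p + (p \Po (- 'X)) - (2 * p.[0])%:P.
have rE x : r.[x] = p.[x] + p.[- x] - 2 * p.[0].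
  by rewrite !hornerE horner_comp !hornerE.
have /factor_theorem[s rs] : root r 0 by apply/eqP; rewrite rE oppr0; ring.
have s0 : s.[0] = 0.
  have : r^`().[0] = 0.
    rewrite /r derivB derivD deriv_comp derivC derivN derivX !hornerE horner_comp.
    rewrite !hornerE oppr0; ring.
  by rewrite rs derivM derivXsubC !hornerE => E; rewrite -[RHS]E; ring.
have /factor_theorem[t st] : root s 0 by apply/eqP.
by exists t => x; rewrite -rE rs st !hornerE; ring.
Qed.

Lemma integrable_integrand p :
  mu.-integrable `]0%R, +oo[%classic (EFin \o integrand p).
Proof.
have [q qE] := symmetrized_divX2 p.
have : mu.-integrable `]0%R, +oo[%classic (EFin \o (fun x => q.[x] * gauss_fun x)).
  apply: (@integrableS _ _ R mu `[0%R, +oo[%classic) => //.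
    by apply: subset_itvr; rewrite bnd_simp.
  exact: integrable_poly_gauss.
apply: eq_integrable => // x; rewrite inE/= in_itv/= andbT => x0.
rewrite qE /gauss_fun; congr _%:E; field.
by rewrite gt_eqF.
Qed.

Lemma wh_linear M p q c : wh M (p + c *: q) = wh M p + c * wh M q.
Proof.
rewrite /wh.
have -> : \int[mu]_(x in `]0, +oo[) integrand (p + c *: q) x =
    \int[mu]_(x in `]0, +oo[) (integrand p x + c * integrand q x).
  by apply: eq_Rintegral => x _; rewrite !(hornerD, hornerZ); ring.
rewrite RintegralD//; [|exact: integrable_integrand|]; last first.
  exact: integrableZl (integrable_integrand q).
rewrite RintegralZl//; last exact: integrable_integrand.
rewrite !hornerE; ring.
Qed.

Lemma wh_gauss_primitive g : g \Po (- 'X) = g ->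
  wh (- (2 * Num.sqrt pi)) ('X * g^`() - g - 2 *: ('X ^+ 2 * g)) = 0.
Proof.
move=> gN; set p := _ - 2 *: _.
have dg0 : g^`().[0] = 0.
  have : g^`().[0] = - g^`().[0].
    rewrite -[in LHS]gN deriv_comp derivN derivX hornerM horner_comp !hornerE.
    by rewrite oppr0 mulrN1.
  lra.
have gNx x : g.[- x] = g.[x] by rewrite -[in RHS]gN horner_comp !hornerE.
have dgNx x : g^`().[- x] = - g^`().[x].
  by rewrite -[in RHS]gN deriv_comp derivN derivX !hornerE horner_comp !hornerE; ring.
(* The natural primitive 2 g(x) exp(- x^2) / x has a pole at 0. Replacing g by g - g(0) removes it
   and leaves a polynomial factor. *)
have /factor_theorem[h gh] : root (g - g.[0]%:P) 0.
  by apply/eqP; rewrite !hornerE subrr.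
have {}gh : g = g.[0]%:P + 'X * h by rewrite mulrC -[X in h * X]subr0 -polyC0 -gh; ring.
(* The integrand is the derivative of k exp(- x^2) minus 4 g(0) exp(- x^2). *)
pose k := 2 *: h.
have k0 : k.[0] = 0.
  by move: dg0; rewrite gh derivD derivC derivM derivX !hornerE => ->; rewrite mulr0.
rewrite /wh.
have -> : \int[mu]_(x in `]0, +oo[) integrand p x = \int[mu]_(x in `]0, +oo[)
    ((k^`() - 2 *: ('X * k)).[x] * gauss_fun x + (- 4 * g.[0]) * gauss_fun x).
  apply: eq_Rintegral => x; rewrite inE/= in_itv/= andbT => x0.
  have pE y : p.[y] = y * g^`().[y] - g.[y] - 2 * (y ^+ 2 * g.[y]).
    by rewrite /p !hornerE.
  rewrite !pE gNx dgNx /gauss_fun.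
  rewrite gh derivD derivC derivM derivX /k derivZ.
  rewrite !(hornerD, hornerN, hornerZ, hornerM, hornerX, hornerC).
  field.
  by rewrite gt_eqF.
have ik := integrable_poly_gauss (k^`() - 2 *: ('X * k)).
have ig : mu.-integrable `[0%R, +oo[%classic (EFin \o @gauss_fun R).
  have := integrable_poly_gauss (1 : {poly R}).
  by apply: eq_integrable => // x _; rewrite /= hornerC mul1r.
have ic : mu.-integrable `[0%R, +oo[%classic
    (EFin \o (fun x => (- 4 * g.[0]) * gauss_fun x)).
  exact: integrableZl ig.
rewrite Rintegral_itv_obnd_cbnd; last first.
  apply: (@integrableS _ _ R mu `[0%R, +oo[%classic) => //.
    by apply: subset_itvr; rewrite bnd_simp.
  exact: integrableD ik ic.
rewrite (RintegralD _ ik ic)// (RintegralZl _ _ ig)//.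
(* The boundary term k(0) = 2 g'(0) is zero by evenness. What remains is - 2 sqrt pi g(0) from the
   Gaussian integral, cancelled by the mass term since p(0) = - g(0). *)
rewrite Rintegral_derive_poly_gauss Rintegral_gauss0y k0.
by rewrite /p !(hornerD, hornerN, hornerZ, hornerM, hornerX, hornerXn); field.
Qed.

End LinearFunctional.

(** * Derivatives, parity and values at 0 of the Hermite polynomials *)

Section HermitePolynomials.
Variable R : realType.
Implicit Type n : nat.

Lemma hermiteSS n :
  hermite R n.+2 = 'X * hermite R n.+1 - (n.+1%:R / 2) *: hermite R n.
Proof. by []. Qed.

Lemma deriv_hermite n : (hermite R n.+1)^`() = n.+1%:R *: hermite R n.
Proof.
elim/ltn_ind: n => -[|[|n]] IH.
- by rewrite /= derivX scale1r.
- rewrite hermiteSS derivB derivM derivX derivZ /= derivC.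
  by rewrite scaler0 subr0 mul1r mulr1 scaler_nat mulr2n.
rewrite hermiteSS derivB derivM derivX derivZ !IH// mul1r -!mul_polyC.
rewrite (hermiteSS n) -!mul_polyC.
set h1 := hermite R n.+1; set h0 := hermite R n.
rewrite !polyCM !polyC_natr; ring.
Qed.

(** This is H_n' = n H_(n-1) with H_(n-1) eliminated by the recurrence, so that n = 0 is covered.
    Used for H_(n-1)', it keeps all derivatives of R_n in the span of H_n and H_(n-1) over the
    polynomials. *)
Lemma deriv_hermite_pred n :
  (hermite R n)^`() = 2 *: ('X * hermite R n) - 2 *: hermite R n.+1.
Proof.
case: n => [|n]; first by rewrite /= derivC mulr1 subrr.
rewrite deriv_hermite hermiteSS scalerBr opprB scalerA addrC subrK.
by congr (_ *: _); field.
Qed.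

Lemma hermite_compN n :
  hermite R n \Po (- 'X) = (-1) ^+ n *: hermite R n.
Proof.
elim/ltn_ind: n => -[|[|n]] IH.
- by rewrite /= comp_polyC scale1r.
- by rewrite /= comp_polyX scaleN1r.
rewrite hermiteSS comp_polyB comp_polyM comp_polyZ comp_polyX !IH//.
rewrite -!mul_polyC !exprS !polyCM !polyCN; ring.
Qed.

(** At 0 the recurrence loses its X term and only multiplies by a nonzero constant. *)
Lemma hermite_even_at0_neq0 m : (hermite R (2 * m)).[0] != 0.
Proof.
elim: m => [|m IH]; first by rewrite hornerC oner_neq0.
rewrite mulnS add2n hermiteSS hornerD hornerM hornerX mul0r add0r hornerN hornerZ.
by rewrite oppr_eq0 !mulf_neq0// invr_eq0 pnatr_eq0.
Qed.

End HermitePolynomials.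

(** * The differential equation, cleared of denominators and then divided *)

Lemma ode_divided (F : fieldType) (d r2 r1 r a b c e : F) : d != 0 ->
  d * r2 - (a * d + b) * r1 + (c * d + e) * r = 0 ->
  r2 - (a + b / d) * r1 + (c + e / d) * r = 0.
Proof.
by move=> d0 E; apply: (mulfI d0); rewrite mulr0 -[RHS]E; field.
Qed.

Lemma tofrac_ode (S : idomainType) (d r2 r1 r a b e : S) (c : nat) : d != 0 ->
  d * r2 - (a * d + b) * r1 + (c%:R * d + e) * r = 0 ->
  r2%:F - (a%:F + b%:F / d%:F) * r1%:F + (c%:R + e%:F / d%:F) * r%:F
  = 0 :> {fraction S}.
Proof.
rewrite -tofrac_eq0 => d0 /(congr1 (fun s => s%:F)).
rewrite !(rmorphD, rmorphN, rmorphM) /= rmorph_nat rmorph0.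
exact: ode_divided.
Qed.

Section DifferentialEquation.
Variables (R : realType) (beta : nat -> R).
Implicit Type n : nat.

Let D n := Bcal beta n - beta n *: Acal beta n.

Lemma RnE n : (1 <= n)%N ->
  Rn beta n = 'X * hermite R n + (beta n - n%:R / 2) *: hermite R n.-1.
Proof.
case: n => // n _; rewrite /Rn succnK hermiteSS -!mul_polyC polyCB; ring.
 Qed.

Lemma deriv_Rn n : (1 <= n)%N ->
  (Rn beta n)^`() =
  Acal beta n * hermite R n + (2 * beta n) *: ('X * hermite R n.-1).
Proof.
case: n => // n _.
rewrite RnE// derivD derivM derivX derivZ deriv_hermite /Acal succnK.
rewrite deriv_hermite_pred -!mul_polyC.
(* Naming the half turns every scalar into an integer polynomial in [c] and [beta], so that [ring]
   meets no division. *)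
set c := n.+1%:R / 2.
have -> : n.+2%:R = 1 + 2 * c :> R by rewrite /c -natr1; field.
have -> : n.+1%:R = 2 * c :> R by rewrite /c; field.
rewrite !(polyCM, polyCB, polyCD) polyC_natr polyC1; ring.
Qed.

(** Once R_n, R_n' and R_n'' are written in H_n and H_(n-1), the coefficients of both cancel
    identically; the two polynomials can be treated as independent indeterminates. *)
Lemma Rn_ode_poly n : (1 <= n)%N ->
  D n * (Rn beta n)^`(2) - (2 *: 'X * D n + (4 * beta n) *: 'X) * (Rn beta n)^`()
  + ((2 * n)%:R * D n + (2 *: Bcal beta n + (2 * beta n) *: Acal beta n)) * Rn beta n
  = 0.
Proof.
move=> n1; rewrite derivnS derivn1 deriv_Rn// RnE//.
case: n n1 => // n _.
rewrite derivD derivM derivZ derivM derivX deriv_hermite deriv_hermite_pred.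
rewrite /D /Bcal /Acal derivC !succnK -!mul_polyC.
have -> : (n.+1 * n.+2)%:R / 2 = (n.+1%:R / 2) * (1 + n.+1%:R) :> R.
  by rewrite natrM -natr1; field.
rewrite natrM -!polyC_natr.
set c := n.+1%:R / 2.
have -> : n.+2%:R = 1 + 2 * c :> R by rewrite /c -natr1; field.
have -> : n.+1%:R = 2 * c :> R by rewrite /c; field.
rewrite !(polyCM, polyCB, polyCD) !polyC_natr polyC1; ring.
Qed.

Lemma Rn_ode n : (1 <= n)%N ->
  (Rn beta n)^`(2)%:F
  - ((2 *: 'X)%:F + ((4 * beta n) *: 'X)%:F / (D n)%:F) * (Rn beta n)^`()%:F
  + ((2 * n)%:R + (2 *: Bcal beta n + (2 * beta n) *: Acal beta n)%:F / (D n)%:F)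
    * (Rn beta n)%:F
  = 0 :> {fraction {poly R}}.
Proof.
move=> n1.
by apply: tofrac_ode; [exact: ode_denominator_neq0|exact: Rn_ode_poly].
Qed.

Lemma beta_even n : (1 <= n)%N -> ~~ odd n -> (Rn beta n)^`().[0] = 0 ->
  beta n = n.+1%:R / 2.
Proof.
move=> n1 n_even.
have h0 : (hermite R n).[0] != 0.
  by rewrite -(even_halfK n_even) -mul2n hermite_even_at0_neq0.
rewrite deriv_Rn// hornerD hornerZ !hornerM hornerX.
rewrite mul0r mulr0 addr0 hornerC => /eqP; rewrite mulf_eq0.
rewrite (negPf h0) orbF subr_eq0 => /eqP ->.
by field.
Qed.

Lemma ode_coefficients n : (1 <= n)%N -> beta n = n.+1%:R / 2 ->
  (2 *: 'X)%:F + ((4 * beta n) *: 'X)%:F / (D n)%:F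
    = (2 *: 'X)%:F + 2 / ('X)%:F :> {fraction {poly R}} /\
  (2 * n)%:R + (2 *: Bcal beta n + (2 * beta n) *: Acal beta n)%:F / (D n)%:F
    = (2 * n.+1)%:R :> {fraction {poly R}}.
Proof.
move=> n1 bE.
have A0 : Acal beta n = 0 by rewrite /Acal bE mulrC divfK ?subrr ?pnatr_eq0.
have BE : Bcal beta n = n.+1%:R *: 'X^2.
  rewrite /Bcal bE scalerBr scalerA divfK ?pnatr_eq0// -[X in _ - X]mul_polyC.
  rewrite -polyCM [X in X%:P + _](_ : _ = n.+1%:R / 2 * n%:R); last first.
    by rewrite natrM; ring.
  by rewrite addrC subrK.
have n0 : n.+1%:R != 0 :> {fraction {poly R}}.
  by rewrite -(rmorph_nat (@tofrac _)) tofrac_eq0 -polyC_natr polyC_eq0 pnatr_eq0.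
have X0 : ('X : {poly R})%:F != 0 by rewrite tofrac_eq0 polyX_eq0.
have b4 : 4 * beta n = 2 * n.+1%:R by rewrite bE; field.
rewrite /D A0 !scaler0 subr0 addr0 b4 BE -!mul_polyC polyCM !polyC_natr expr2.
rewrite !(rmorphM, rmorph_nat) /=.
(* Both cancellations are done in an abstract field, then used with v = n + 1 and w = X. *)
have cancelX (F : fieldType) (u v w : F) : v != 0 -> w != 0 ->
    u * v * w / (v * (w * w)) = u / w.
  by move=> v0 w0; field; rewrite v0 w0.
have cancelXX (F : fieldType) (v w : F) : v != 0 -> w != 0 ->
    (2 * n)%:R + 2 * (v * (w * w)) / (v * (w * w)) = (2 * n.+1)%:R.
  by move=> v0 w0; rewrite mulfK ?mulf_neq0// mulnS addnC natrD.
by split; [congr (_ + _); exact: cancelX n0 X0|exact: cancelXX n0 X0].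
Qed.

End DifferentialEquation.

(** * The coefficients of odd index for the mass - 2 sqrt pi *)

Section SpecialMass.
Variables (R : realType) (beta : nat -> R).
Local Notation M := (- (2 * Num.sqrt (@pi R))).

Lemma wh_hermite_even_rec m :
  wh M (hermite R (2 * m).+2 + m.+1%:R *: hermite R (2 * m)) = 0.
Proof.
(* With this factor - 2 X^2 g cancels the X^2 H_(2m) coming from X g', which leaves X H_(2m+1) +
   H_(2m) / 2. *)
set g := - (1 / 2) *: hermite R (2 * m).
suff -> : hermite R (2 * m).+2 + m.+1%:R *: hermite R (2 * m) =
    'X * g^`() - g - 2 *: ('X^2 * g).
  apply: wh_gauss_primitive.
  by rewrite comp_polyZ hermite_compN exprM sqrrN !expr1n scale1r.
have g2 : 2 *: g = - hermite R (2 * m).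
  by rewrite scalerA mulrN mulrC divfK ?pnatr_eq0// scaleN1r.
have dg : g^`() = hermite R (2 * m).+1 - 'X * hermite R (2 * m).
  rewrite derivZ deriv_hermite_pred -[X in _ *: X]scalerBr scalerA mulNr divfK ?pnatr_eq0//.
  by rewrite scaleN1r opprB.
have -> : m.+1%:R = (2 * m).+1%:R / 2 + 1 / 2 :> R.
  by rewrite -!natr1 natrM; field.
rewrite scalerAr g2 dg hermiteSS /g scaleNr -!mul_polyC polyCD; ring.
Qed.

Lemma beta_odd n : (1 <= n)%N -> odd n ->
  wh M (hermite R n.-1) != 0 -> wh M (Rn beta n) = 0 -> beta n = n.+1%:R / 2.
Proof.
case: n => // n _ /= n_even; rewrite /Rn succnK => hn0 wh0.
have nE : n = (2 * n./2)%N by rewrite mul2n even_halfK.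
have := wh_hermite_even_rec n./2; rewrite -nE.
(* Both relations express w_h(H_(2m+2)) as a multiple of w_h(H_(2m)), which is nonzero; hence the
   coefficient is m + 1. *)
move: wh0; rewrite !wh_linear => /eqP; rewrite addr_eq0 => /eqP -> /eqP.
rewrite addrC subr_eq0 => /eqP/(mulIf hn0) <-.
by rewrite [in RHS]nE -!natr1 natrM; field.
Qed.

End SpecialMass.

Theorem theorem3p10 (R : realType) (M : R) (beta : nat -> R)
  (hM : M != 0)
  (hreg : forall n : nat, wh M (hermite R (2 * n)) != 0)
  (hder : forall n : nat, (1 <= n)%N -> (Rn beta n)^`().[0] = 0)
  (hwh : forall n : nat, (1 <= n)%N -> wh M (Rn beta n) = 0) :
  (forall n : nat, (1 <= n)%N ->
    (Rn beta n)^`(2)%:F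
    - ((2 *: 'X)%:F + ((4 * beta n) *: 'X)%:F
         / (Bcal beta n - beta n *: Acal beta n)%:F)
      * (Rn beta n)^`()%:F
    + ((2 * n)%:R + (2 *: Bcal beta n + (2 * beta n) *: Acal beta n)%:F
         / (Bcal beta n - beta n *: Acal beta n)%:F)
      * (Rn beta n)%:F
    = 0 :> {fraction {poly R}})
  /\
  (M = - (2 * Num.sqrt pi) ->
   forall n : nat, (1 <= n)%N ->
    [/\ (2 *: 'X)%:F + ((4 * beta n) *: 'X)%:F
          / (Bcal beta n - beta n *: Acal beta n)%:F
        = (2 *: 'X)%:F + 2 / ('X)%:F :> {fraction {poly R}},
        (2 * n)%:R + (2 *: Bcal beta n + (2 * beta n) *: Acal beta n)%:F
          / (Bcal beta n - beta n *: Acal beta n)%:F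
        = (2 * n.+1)%:R :> {fraction {poly R}}
      & (Rn beta n)^`(2)%:F
        - ((2 *: 'X)%:F + 2 / ('X)%:F) * (Rn beta n)^`()%:F
        + (2 * n.+1)%:R * (Rn beta n)%:F
        = 0 :> {fraction {poly R}}]).
Proof.
split=> [n n1|ME n n1]; first exact: Rn_ode.
have bE : beta n = n.+1%:R / 2.
  (* Even indices use the condition at 0, odd ones the functional; for odd n the regularity
     hypothesis applies because n - 1 is even. *)
  have [n_odd|n_even] := boolP (odd n); last exact: beta_even (hder n n1).
  apply: beta_odd => //; last by rewrite -ME; exact: hwh.
  have -> : n.-1 = (2 * n./2)%N by rewrite mul2n -[in LHS](odd_double_half n) n_odd.
  by rewrite -ME; exact: hreg.
have [c1 c2] := ode_coefficients n1 bE.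
by split=> //; rewrite -c1 -c2; exact: Rn_ode.
Qed.
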